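(* Let $M\neq 0$ be a squarefree submodule of a finitely generated $\mathbb{Z}^n$-graded free $S$-module, and let $d+1$ be the smallest (total) degree of a generator of $M$. Let $$\cdots\to F_p\to F_{p-1}\to\cdots\to F_1\to M\to0$$ be a (not necessarily minimal) squarefree resolution of $M$. Let $p\ge1$ be an integer for which there is an integer $s$ with $(2s+1)(s+1)\le n+1-d-p$, and let $s$ be the largest such integer. Then the $p$-th syzygy module $Z_p\subseteq F_p$ is either free, or it has Stanley depth greater than or equal to $2s+1+d+p$. Explicitly, $$2s+1+d+p=2\left\lfloor\frac{\sqrt{2n-2d-2p+2.25}+0.5}{2}\right\rfloor+d+p-1.$$
   Context: $K$ is a field and $S=K[x_1,\dots,x_n]$ with its standard $\mathbb{Z}^n$-grading; $\epsilon_i$ is the $i$-th unit vector of $\mathbb{Z}^n$. The total degree of a homogeneous element of multidegree $\mathbf a\in\mathbb{Z}^n$ is $a_1+\cdots+a_n$. Squarefree modules: a finitely generated $\mathbb{Z}^n$-graded $S$-module $M$ is squarefree if (i) $M_{\mathbf a}\ne0$ only if $\mathbf a\in\mathbb{N}^n$, and (ii) whenever $\mathbf a\in\mathbb{N}^n$ has nonzero $i$-th coordinate, multiplication by $x_i$, $M_{\mathbf a}\to M_{\mathbf a+\epsilon_i}$, is an isomorphism of vector spaces. A squarefree resolution is a $\mathbb{Z}^n$-graded free resolution all of whose terms $F_i$ are finitely generated free modules which are squarefree (equivalently, their basis elements have multidegrees in $\{0,1\}^n$). Syzygy modules: $Z_1=\ker(F_1\to M)$ and $Z_p=\ker(F_p\to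 F_{p-1})$ for $p\ge2$. The zero module is free. Stanley depth: a Stanley decomposition of a finitely generated $\mathbb{Z}^n$-graded $S$-module $N$ is a finite direct sum decomposition $N=\bigoplus_{i=1}^r u_iK[Z_i]$ as a $\mathbb{Z}^n$-graded $K$-vector space, where each $u_i\in N$ is a homogeneous element, $Z_i\subseteq\{x_1,\dots,x_n\}$ is a set of variables (here $Z_i$ does not denote a syzygy module), and $u_iK[Z_i]$ is a free $K[Z_i]$-submodule of $N$. The Stanley depth of the decomposition is $\min_i|Z_i|$, and the Stanley depth of $N$ is the maximum of the Stanley depths of its Stanley decompositions. *)

(* Defs.v *)
From mathcomp Require Import all_boot all_order all_algebra.
From mathcomp Require Import mpoly.

Set Implicit Arguments.
Unset Strict Implicit.
Unset Printing Implicit Defensive.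

Import Order.TTheory GRing.Theory Num.Theory.
Local Open Scope ring_scope.

(* Multidegrees: the group Z^n. *)
Notation multideg n := {ffun 'I_n -> int}.

Definition eps (n : nat) (i : 'I_n) : multideg n :=
  [ffun j => (j == i)%:Z].

Definition mon_deg (n : nat) (m : 'X_{1..n}) : multideg n :=
  [ffun j => (m j)%:Z].

Definition total_degree (n : nat) (a : multideg n) : int :=
  \sum_(i < n) a i.

(* P is the internal direct sum of the family U, indexed by a possibly
   infinite set I; both P and the U i are meant to be additive subgroups. *)
Definition direct_sum (V : zmodType) (I : eqType) (U : I -> V -> Prop)
    (P : V -> Prop) : Prop :=
  [/\ forall i v, U i v -> P v,
      forall v, P v -> exists (s : seq I) (w : I -> V),
        [/\ uniq s, forall i, i \in s -> U i (w i) & v = \sum_(i <- s) w i]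
    & forall (s : seq I) (w : I -> V),
        uniq s -> (forall i, i \in s -> U i (w i)) ->
        \sum_(i <- s) w i = 0 -> forall i, i \in s -> w i = 0].

(* Z^n-graded modules over S = K[x_1, ..., x_n]; [homogeneous a] is the component
   of multidegree a. Since S_b is spanned over K by a single monomial if b is
   in N^n, and is 0 otherwise, [homogeneous_monom] says that S_b M_a is contained in
   M_(a + b). *)
Record gradedModule (K : fieldType) (n : nat) := GradedModule {
  gmod_sort :> lmodType {mpoly K[n]};
  homogeneous : multideg n -> gmod_sort -> Prop;
  homogeneous0 : forall a, homogeneous a 0;
  homogeneousD : forall a v w, homogeneous a v -> homogeneous a w -> homogeneous a (v + w);
  homogeneous_monom : forall a (c : K) (m : 'X_{1..n}) v,
    homogeneous a v -> homogeneous (a + mon_deg m) ((c *: 'X_[m]) *: v);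
  homogeneous_direct : direct_sum homogeneous (fun _ : gmod_sort => True)
}.

Section Submodules.
Variables (K : fieldType) (n : nat) (V : gradedModule K n).
Local Notation S := {mpoly K[n]}.
Implicit Types (P : V -> Prop).

(* Modules are handled as submodules P of an ambient graded module V; V itself
   is [whole V]. *)
Definition whole : V -> Prop := fun _ => True.

Definition submodule P : Prop :=
  [/\ P 0, forall v w, P v -> P w -> P (v + w) & forall (f : S) v, P v -> P (f *: v)].

Definition component P (a : multideg n) : V -> Prop :=
  fun v => P v /\ homogeneous a v.

Definition graded_submodule P : Prop :=
  submodule P /\ direct_sum (component P) P.

Definition generates r (g : 'I_r -> V) P : Prop :=
  forall v, P v <-> exists c : 'I_r -> S, v = \sum_(i < r) c i *: g i.

Definition finitely_generated P : Prop :=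
  exists r (g : 'I_r -> V), generates g P.

(* Free of finite rank as a graded module: there is a finite homogeneous basis.
   The empty basis (r = 0) makes the zero module free. *)
Definition graded_free P : Prop :=
  exists r (g : 'I_r -> V),
    [/\ forall i, exists a, homogeneous a (g i),
        generates g P
      & forall c : 'I_r -> S,
          \sum_(i < r) c i *: g i = 0 -> forall i, c i = 0].

Definition squarefree P : Prop :=
  [/\ graded_submodule P,
      finitely_generated P,
      forall a v, component P a v -> v <> 0 -> forall i, 0 <= a i
    & forall (a : multideg n) i, (forall j, 0 <= a j) -> a i <> 0 ->
        forall w, component P (a + eps i) w ->
          exists! v, component P a v /\ ('X_i : S) *: v = w].

(* e is the smallest total degree of an element of a minimal (irredundant)
   system of homogeneous generators of P; this e does not depend on the
   system. *)
Definition smallest_generator_degree P (e : int) : Prop :=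
  exists r (g : 'I_r -> V) (a : 'I_r -> multideg n),
    [/\ forall i, homogeneous (a i) (g i),
        generates g P,
        forall i, ~ exists c : 'I_r -> S, g i = \sum_(j < r | j != i) c j *: g j,
        exists i, total_degree (a i) = e
      & forall i, e <= total_degree (a i)].

(* The subring K[Z] of S, where the set Z of variables is given by their
   indices. *)
Definition in_variables (Z : {set 'I_n}) (f : S) : Prop :=
  forall (m : 'X_{1..n}) i, m \in msupp f -> m i != 0%N -> i \in Z.

Definition stanley_space (u : V) (Z : {set 'I_n}) : V -> Prop :=
  fun v => exists2 f : S, in_variables Z f & v = f *: u.

(* The second condition says that u_i is a basis of u_i K[Z_i] over K[Z_i]; in
   particular u_i is nonzero. *)
Definition stanley_decomposition P r (u : 'I_r -> V) (Z : 'I_r -> {set 'I_n}) :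
    Prop :=
  [/\ forall i, P (u i) /\ exists a, homogeneous a (u i),
      forall i (f : S), in_variables (Z i) f -> f *: u i = 0 -> f = 0
    & direct_sum (fun i => stanley_space (u i) (Z i)) P].

(* The minimum of the #|Z i|. As #|Z i| <= n, the neutral value n matters only
   for the empty decomposition (r = 0) of the zero module. *)
Definition decomposition_depth r (Z : 'I_r -> {set 'I_n}) : nat :=
  \big[minn/n]_(i < r) #|Z i|.

(* k is the Stanley depth of P, that is, the maximum of the depths of its
   Stanley decompositions. *)
Definition is_stanley_depth P (k : nat) : Prop :=
  (exists r (u : 'I_r -> V) (Z : 'I_r -> {set 'I_n}),
     stanley_decomposition P u Z /\ decomposition_depth Z = k) /\
  (forall r (u : 'I_r -> V) (Z : 'I_r -> {set 'I_n}),
     stanley_decomposition P u Z -> (decomposition_depth Z <= k)%N).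

End Submodules.

Arguments whole {K n} V _.

Definition degree_preserving (K : fieldType) n (V W : gradedModule K n)
    (f : V -> W) : Prop :=
  forall a v, homogeneous a v -> homogeneous a (f v).

(* Squarefree resolutions ... -> F_2 -> F_1 -> M -> 0 of a submodule M of G.
   The index is shifted: [res_mod q] is F_(q+1), [res_diff q] is
   F_(q+2) -> F_(q+1), and [res_aug] is F_1 -> M followed by the inclusion of
   M in G. *)
Record squarefreeResolution (K : fieldType) (n : nat) (G : gradedModule K n)
    (M : G -> Prop) := SquarefreeResolution {
  res_mod : nat -> gradedModule K n;
  res_diff : forall q, {linear res_mod q.+1 -> res_mod q};
  res_aug : {linear res_mod 0%N -> G};
  res_free : forall q, graded_free (whole (res_mod q));
  res_squarefree : forall q, squarefree (whole (res_mod q));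
  res_diff_deg : forall q, degree_preserving (res_diff q);
  res_aug_deg : degree_preserving res_aug;
  res_aug_image : forall v, M v <-> exists w, res_aug w = v;
  res_exact0 : forall v, res_aug v = 0 <-> exists w, res_diff 0%N w = v;
  res_exactS : forall q v,
    res_diff q v = 0 <-> exists w, res_diff q.+1 w = v
}.

(* For p >= 1, the p-th syzygy module Z_p, as a submodule of F_p = res_mod p.-1;
   the value at p = 0 is irrelevant. *)
Definition syzygy (K : fieldType) (n : nat) (G : gradedModule K n)
    (M : G -> Prop) (F : squarefreeResolution M) (p : nat) :
    res_mod F p.-1 -> Prop :=
  match p with
  | q.+2 => fun v => res_diff F q v = 0
  | _ => fun v => res_aug F v = 0
  end.
Arguments syzygy {K n G M} F p _.

(* Main.v *)
Require Import Defs.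
From mathcomp Require Import all_boot all_order all_algebra.
From mathcomp Require Import mpoly.
From mathcomp Require Import boolp reals.
From mathcomp Require Import zify lra ring.

Set Implicit Arguments.
Unset Strict Implicit.
Unset Printing Implicit Defensive.

Import Order.TTheory GRing.Theory Num.Theory.

(** Write D = d + p and N = n + 1 - D, and give the basis of each F_q the labels
a_j, where the basis element e_j has multidegree the indicator of the set a_j. A
homogeneous element of F_q is determined by its multidegree and a vector of
coefficients in K, so the resolution becomes a sequence of matrices over K, and
the component of Z_p in any multidegree b >= 0 is identified with the space Z_C
of kernel vectors supported on {j : a_j contained in C}, C being the support
of b.

Order the basis by the cardinal of a_j, call the largest index of a nonzero
coordinate the leading index of a vector, and let P_j be the set of all C for
which Z_C contains a vector with leading index j; it is an up-set of sets
containing a_j. If every P_j is partitioned into intervals [A, B], then choosing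
in Z_A a vector with leading index j for each of them gives elements u of Z_p,
and the spaces u K[x_l, l in B] form a Stanley decomposition of Z_p, by Gaussian
elimination in each multidegree ([st_decomposition]).

Two facts bound the sets B from below.

Algebra ([low_lead_all]): if #|a_j| < D, then P_j is empty or contains a_j. The
part of F_p in low degrees only contributes free summands to Z_p, because M
vanishes in total degree at most d. This goes by induction on p: a leading
vector z of Z_p is truncated to the coordinates labelled exactly a_j; its image
is a kernel vector supported strictly below a_j, to which the induction
hypothesis and exactness apply ([low_decomp]), and correcting the truncation
accordingly produces an element of Z_(a_j) with the same leading index. When
a_j is in P_j, the single interval [a_j, [n]] will do.

Combinatorics ([proper_upset_partition]): if P_j is nonempty and does not contain
a_j, then #|a_j| >= D, and removing a_j turns P_j into an up-set of nonempty subsets of a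
set of m = n - #|a_j| points. Placing these points on a circle, each set A gets
a set of gaps. If the bottoms are chosen greedily by increasing cardinal, then
intervals [A, A + gaps A] cover the sets of fewer than t elements in the up-set
without overlap ([gaps_cross]), and all the tops have at least t elements when
(k + 1)(t + 1 - k) <= m + 1 for 0 < k < t ([gaps_card]). For #|a_j| = D and
t = 2s + 1 the largest of these products is (s + 1)(s + 2), which is at most
(2s + 1)(s + 1) <= N = m + 1 when s >= 1; when s <= 0 there is no such k. Each
further element of a_j lowers t and m by one, and the condition persists.

So all the tops B have at least min (n, 2s + 1 + D) elements. If 2s + 1 + D
exceeds n, then all of them are full and Z_p is free. *)

(** * Gaps of a subset of a circle *)
Section Cyclic.
Variable m : nat.
Implicit Types (x y z : 'I_m) (A B : {set 'I_m}).

(** The number of steps from y forward to x on the circle 'I_m. *)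
Definition cdist y x : nat := if y <= x then x - y else x + m - y.

(** The arc from y forward to x, both ends included. *)
Definition cyc_arc y x : {set 'I_m} := [set z | cdist y z <= cdist y x].

(** With k = #|A|, a point x is a gap of A if on every arc ending at x the density
of A is less than (k + 1) / (m + 2). The strict inequality on the arc {x} shows
that no gap lies in A. *)
Definition gaps A : {set 'I_m} :=
  [set x | [forall y, m.+2 * #|A :&: cyc_arc y x| < #|A|.+1 * (cdist y x).+1]].

Lemma cdistD x y : x != y -> cdist x y + cdist y x = m.
Proof.
move=> nxy; have {nxy} : x != y :> nat by [].
by have := ltn_ord x; have := ltn_ord y; rewrite /cdist; do 2?case: ifP; lia.
Qed.

Lemma arc_compl x y z : x != y -> z \notin cyc_arc x y -> cdist y z < cdist y x.
Proof.
move=> nxy; have {nxy} : x != y :> nat by [].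
rewrite inE -ltnNge /cdist.
by have := ltn_ord x; have := ltn_ord y; have := ltn_ord z; do 4?case: ifP; lia.
Qed.

(** The sets A + gaps A separate: this makes intervals with different bottoms
disjoint, unless one bottom lies in the interval of the other. *)
Lemma gaps_cross A A' : #|A| <= #|A'| ->
  A \subset A' :|: gaps A' -> A' \subset A :|: gaps A -> A \subset A'.
Proof.
move=> lekk' sAA' sA'A; apply/subsetP=> y0 y0A; apply: contraT => y0A'.
have [x0 x0A' x0A] : exists2 x, x \in A' & x \notin A.
  apply/subsetPn; apply: contra y0A' => sub.
  by have /eqP -> : A' == A by rewrite eqEcard sub.
pose pr := [pred yx : 'I_m * 'I_m | [&& yx.1 \in A, yx.1 \notin A',
   yx.2 \in A' & yx.2 \notin A]].
have pr0 : pr (y0, x0) by rewrite /pr /= y0A y0A' x0A' x0A.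
(* Choose y in A \ A' and x in A' \ A at the smallest distance: then A and A'
   agree strictly between y and x. *)
case: (arg_minnP (fun yx => cdist yx.1 yx.2) pr0) => -[y x] /=.
case/and4P=> yA yA' xA' xA min.
have /subsetP/(_ y yA) := sAA'; rewrite inE (negbTE yA') /= inE => /forallP/(_ x) H1.
have /subsetP/(_ x xA') := sA'A; rewrite inE (negbTE xA) /= inE => /forallP/(_ y) H2.
have nxy : x != y by apply: contraNneq xA => ->.
have card : #|A'| < #|A' :&: cyc_arc x y| + #|A :&: cyc_arc y x|.
  rewrite -[in X in X < _](cardsID (cyc_arc x y) A') ltn_add2l.
  have yin : y \in A :&: cyc_arc y x by rewrite !inE yA /cdist leqnn subnn.
  rewrite [X in _ < X](cardsD1 y) yin ltnS; apply/subset_leq_card/subsetP => z.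
  rewrite inE => /andP[/(arc_compl nxy) zlt zA'].
  have zy : z != y by apply: contraTneq zA' => ->.
  rewrite !inE zy (ltnW zlt) andbT /=; apply: contraT => zA.
  have := min (y, z); rewrite /pr /= yA yA' zA' zA => /(_ isT).
  by rewrite leqNgt zlt.
have := cdistD nxy.
(* The lengths of the two arcs add up to m + 2, as both contain x and y, so the
   gap inequalities for x and y add up to a contradiction. *)
have : #|A|.+1 * (cdist y x).+1 <= #|A'|.+1 * (cdist y x).+1.
  by rewrite leq_mul2r ltnS lekk' orbT.
have : m.+2 * #|A'|.+1 <= m.+2 * (#|A' :&: cyc_arc x y| + #|A :&: cyc_arc y x|).
  by rewrite leq_mul2l card orbT.
move: H1 H2; move: (#|_ :&: _|) (#|_ :&: _|) (cdist _ _) (cdist _ _) (#|A|).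
by move=> a b c e k; nia.
Qed.

End Cyclic.

(** ** Counting gaps by the records of a walk *)
Section Records.
Variable h : nat -> int.
Local Open Scope ring_scope.

(** At step i the walk h goes strictly below all its previous values. *)
Definition record_time i := [forall j : 'I_i.+1, h i.+1 < h j].

Lemma record_timeP i : reflect (forall j, (j <= i)%N -> h i.+1 < h j) (record_time i).
Proof.
apply: (iffP forallP) => H j; last exact: H (leq_ord j).
by rewrite -ltnS => ji; exact: (H (Ordinal ji)).
Qed.

(** A walk that goes down by at most c at each step needs many record times
to get from above mu down to h j. *)
Lemma record_count (c mu : int) (a b j : nat) :
  0 <= c -> (forall i, h i - h i.+1 <= c) ->
  (forall i, (i <= a)%N -> mu <= h i) -> (j <= a + b)%N ->
  mu - h j <= c * (\sum_(i < b) record_time (i + a))%N%:Z.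
Proof.
move=> c_ge0 step low; elim: b j => [|b IHb] j.
  by rewrite addn0 big_ord0 => /low; lia.
rewrite addnS big_ord_recr /=; set S := (\sum_(i < b) _)%N in IHb *.
rewrite leq_eqVlt => /predU1P[->|]; last first.
  rewrite ltnS => /IHb /le_trans; apply.
  by apply: ler_wpM2l => //; rewrite lez_nat leq_addr.
case: record_timeP => [_|nrec].
  have := IHb (a + b)%N (leqnn _); have := step (a + b)%N.
  by rewrite /=; nia.
have [j' j'le hj'] : exists2 j', (j' <= b + a)%N & h j' <= h (b + a).+1.
  have /forallPn[j'] : ~~ record_time (b + a) by apply/record_timeP.
  by rewrite -leNgt => ?; exists (val j') => //; exact: leq_ord.
have := IHb j'; rewrite addnC => /(_ j'le).
by move: hj'; rewrite (addnC b a) /=; nia.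
Qed.

End Records.

Section GapCount.
Variables (m : nat) (A : {set 'I_m}).

(** A as an m-periodic predicate on nat, and its counting function. *)
Definition periodic (t : nat) : bool := [exists z in A, val z == t %% m].

Definition ccount (i : nat) : nat := count periodic (iota 0 i).

Lemma periodicD t : periodic (m + t) = periodic t.
Proof. by rewrite /periodic modnDl. Qed.

Lemma periodic_val (z : 'I_m) : periodic z = (z \in A).
Proof.
apply/existsP/idP => [[z' /andP[z'A /eqP]]|zA].
  by rewrite modn_small // => /val_inj <-.
by exists z; rewrite zA modn_small //=.
Qed.

Lemma ccountDm i : ccount (m + i) = #|A| + ccount i.
Proof.
rewrite /ccount iotaD count_cat; congr (_ + _).
  rewrite -val_enum_ord count_map -sum1_card -sum1_count big_enum_cond /=.
  by apply: eq_bigl => z; rewrite periodic_val.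
rewrite add0n -[X in iota X i]addn0 iotaDl count_map.
by apply: eq_count => t /=; rewrite periodicD.
Qed.

Lemma arc_count (x y : 'I_m) :
  #|A :&: cyc_arc y x| + ccount (x + m - cdist y x) <= ccount (x + m).+1.
Proof.
have lexm := ltn_ord x; have leym := ltn_ord y.
have le1 : cdist y x <= x + m by rewrite /cdist; case: ifP; lia.
have -> : (x + m).+1 = (x + m - cdist y x) + (cdist y x).+1 by lia.
rewrite /ccount iotaD count_cat addnC leq_add2l add0n.
rewrite -size_filter cardE.
pose f (z : 'I_m) : nat := if z <= x then z + m else z.
rewrite -(size_map f); apply: uniq_leq_size.
  rewrite map_inj_uniq ?enum_uniq // => z z' /eqP eqf; apply/val_inj.
  by move: eqf; rewrite /f /=; have := ltn_ord z; have := ltn_ord z'; do 2?case: ifP; lia.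
move=> _ /mapP[z + ->]; rewrite mem_enum !inE => /andP[zA zarc].
rewrite mem_filter mem_iota; apply/andP; split.
  by rewrite -periodic_val in zA; rewrite /f; case: ifP; rewrite // addnC periodicD.
by have lezm := ltn_ord z; move: zarc; rewrite /f /cdist; do 3?case: ifP; lia.
Qed.

(** Walk around the circle with the height (m + 2) #(A in [0, i)) - (k + 1) i. It
goes down by m - 2k in each turn and by at most k + 1 in each step, and its record
times in the second turn are gaps; hence there are at least (m - 2k) / (k + 1)
gaps. *)
Lemma gaps_card : m <= #|A|.+1 * #|gaps A| + 2 * #|A|.
Proof.
pose h (i : nat) : int := ((m.+2 * ccount i)%:Z - (#|A|.+1 * i)%:Z)%R.
pose j0 := [arg min_(j < (ord0 : 'I_m.+1)) h j]%O.
have min0 i : i <= m -> (h j0 <= h i)%R.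
  rewrite /j0; case: Order.TotalTheory.arg_minP => //= j _ + im.
  by move/(_ (inord i) isT); rewrite inordK.
have step i : (h i - h i.+1 <= #|A|.+1%:Z)%R.
  have : ccount i <= ccount i.+1 by rewrite /ccount -[i.+1]addn1 iotaD count_cat leq_addr.
  by rewrite /h; nia.
have := @record_count h #|A|.+1%:Z (h j0) m m (m + j0) _ step min0.
rewrite leq_add2l leq_ord => /(_ isT isT).
have -> : (h j0 - h (m + j0) = m%:Z - 2 * #|A|%:Z)%R.
  by rewrite /h ccountDm; nia.
have : \sum_(i < m) record_time h (i + m) <= #|gaps A|.
  rewrite -sum1_card [X in _ <= X]big_mkcond; apply: leq_sum => x _.
  case: record_timeP => // rec; rewrite inE; case: forallP => // -[] y.
  have le1 : cdist y x <= x + m by rewrite /cdist; have := ltn_ord y; case: ifP; lia.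
  have := rec (x + m - cdist y x) (leq_subr _ _).
  by rewrite /h; have := arc_count x y; nia.
by move: (\sum_(i < m) _) => S; nia.
Qed.

End GapCount.

(** * Interval partitions of up-sets *)

(** The intervals [A, top A], for A in Q, partition P, provided that P is an up-set:
each member of P lies in exactly one of them. *)
Definition interval_partition (T : finType) (P : pred {set T})
    (Q : {set {set T}}) (top : {set T} -> {set T}) : Prop :=
  [/\ forall A, A \in Q -> P A /\ A \subset top A,
      forall C, P C -> exists2 A, A \in Q & A \subset C /\ C \subset top A
    & forall A A' (C : {set T}), A \in Q -> A' \in Q -> A \subset C -> C \subset top A ->
        A' \subset C -> C \subset top A' -> A = A'].

(** Take the sets of P by increasing cardinal, and open the interval [A, top A]
whenever A is not in a previous one. *)
Lemma greedy_partition (T : finType) (P : pred {set T})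
    (top : {set T} -> {set T}) :
  (forall A : {set T}, A \subset top A) ->
  (forall A A' : {set T}, P A -> P A' -> #|A| <= #|A'| ->
     A \subset top A' -> A' \subset top A -> A \subset A') ->
  exists Q, interval_partition P Q top.
Proof.
move=> sub_top cross.
suff [Q [QP cover inj]] : exists Q : {set {set T}},
    [/\ forall A, A \in Q -> P A /\ #|A| < #|T|.+1,
        forall C, P C -> #|C| < #|T|.+1 ->
          exists2 A, A \in Q & A \subset C /\ C \subset top A
      & forall A A' (C : {set T}), A \in Q -> A' \in Q ->
        A \subset C -> C \subset top A ->
        A' \subset C -> C \subset top A' -> A = A'].
  exists Q; split=> [A /QP[]|C PC|]; [by split | | by []].
  by apply: cover => //; rewrite ltnS max_card.
elim: #|T|.+1 => [|m [Q [QP cover inj]]].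
  by exists set0; split=> [A|C|A A' C]; rewrite ?inE ?ltn0.
(* Add all the sets of size m that are not yet covered. *)
pose new := [set A | [&& P A, #|A| == m &
  [forall A0 in Q, ~~ ((A0 \subset A) && (A \subset top A0))]]].
have inj_new (A A' C : {set T}) : A \in Q :|: new -> A' \in new ->
    A \subset C -> C \subset top A -> A' \subset C -> C \subset top A' -> A = A'.
  move=> AQ; rewrite inE => /and3P[PA' /eqP cA' /'forall_implyP ncov] AC CA A'C CA'.
  have [PA cA] : P A /\ #|A| <= m.
    move: AQ; rewrite !inE => /orP[/QP[PA lt]|/and3P[PA /eqP-> _]]; last by [].
    by rewrite ltnW.
  have sAA' : A \subset A'.
    apply: cross => //; first by rewrite cA'.
      exact: subset_trans AC CA'.
    exact: subset_trans A'C CA.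
  move: AQ; rewrite inE => /orP[AQ|].
    by have := ncov _ AQ; rewrite sAA' (subset_trans A'C CA).
  rewrite inE => /and3P[_ /eqP cAm _].
  by apply/eqP; rewrite eqEcard sAA' cA' cAm leqnn.
exists (Q :|: new); split.
- move=> A; rewrite !inE => /orP[/QP[PA lt]|/and3P[PA /eqP-> _]]; last by [].
  by split; rewrite // ltnW.
- move=> C PC; rewrite ltnS leq_eqVlt => /orP[/eqP cC|/cover]; last first.
    by case=> // A AQ ?; exists A; rewrite // inE AQ.
  have [Cnew|] := boolP (C \in new).
    by exists C; [rewrite inE Cnew orbT | rewrite subxx sub_top].
  rewrite inE PC cC eqxx /= => /forallPn[A0]; rewrite negb_imply negbK.
  by case/andP=> A0Q /andP[? ?]; exists A0; rewrite // inE A0Q.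
- move=> A A' C AQ A'Q AC CA A'C CA'.
  have [A'new|nA'] := boolP (A' \in new); first exact: (inj_new A A' C).
  have [Anew|nA] := boolP (A \in new).
    by apply/esym; exact: (inj_new A' A C).
  move: AQ A'Q; rewrite !inE in nA nA' *.
  by rewrite (negbTE nA) (negbTE nA') !orbF => AQ A'Q; exact: (inj _ _ C).
Qed.

Section Cap.
Variables (m t : nat).
Implicit Types A : {set 'I_m}.

(** The top of the interval opened at A, when tops of at least t elements are
sought. *)
Definition cap A : {set 'I_m} := if #|A| < t then A :|: gaps A else A.

Lemma sub_cap A : A \subset cap A.
Proof. by rewrite /cap; case: ifP; rewrite ?subsetUl. Qed.

Lemma cap_cross A A' : #|A| <= #|A'| ->
  A \subset cap A' -> A' \subset cap A -> A \subset A'.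
Proof.
move=> lekk'; rewrite /cap; case: ltnP => [lt'|//].
by rewrite (leq_ltn_trans lekk' lt'); apply: gaps_cross.
Qed.

Lemma cap_card A :
  (forall k, 0 < k -> k < t -> k.+1 * (t.+1 - k) <= m.+1) ->
  A != set0 -> t <= #|cap A|.
Proof.
move=> bound; rewrite -card_gt0 /cap => A0; case: (ltnP #|A| t) => // lt.
have dis : A :&: gaps A = set0.
  apply/setP=> x; rewrite !inE; apply/negP => /andP[xA /forallP/(_ x)].
  have : 0 < #|A :&: cyc_arc x x|.
    by rewrite card_gt0; apply/set0Pn; exists x; rewrite !inE xA leqnn.
  have : #|A| <= m by rewrite -[X in _ <= X]card_ord max_card.
  by rewrite /cdist leqnn subnn; nia.
have := cardsUI A (gaps A); rewrite dis cards0.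
by have := bound _ A0 lt; have := gaps_card A; nia.
Qed.

End Cap.

(** The points outside a are placed on a circle, and a is added back to the
resulting intervals. *)
Lemma proper_upset_partition (T : finType) (a : {set T}) (P : pred {set T}) (t : nat) :
  (forall C : {set T}, P C -> a \proper C) ->
  (forall k, 0 < k -> k < t -> k.+1 * (t.+1 - k) <= (#|T| - #|a|).+1) ->
  exists Q top, interval_partition P Q top /\
    forall A, A \in Q -> #|a| + t <= #|top A|.
Proof.
move=> aP bound; pose f (x : 'I_#|~: a|) : T := enum_val x.
have f_inj : injective f := @enum_val_inj _ _.
have f_a x : f x \notin a by have := enum_valP x; rewrite inE.
pose up (C : {set 'I_#|~: a|}) := a :|: f @: C; pose dn (C : {set T}) := f @^-1: C.
have upK C : dn (up C) = C.
  by apply/setP => x; rewrite !inE (negbTE (f_a x)) mem_imset.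
have dnK (C : {set T}) : a \subset C -> up (dn C) = C.
  move=> aC; apply/setP => x; rewrite inE; apply/idP/idP => [/orP[/(subsetP aC)//|]|xC].
    by case/imsetP=> y; rewrite inE => ? ->.
  have [//|xa] := boolP (x \in a); apply/imsetP.
  have xa' : x \in ~: a by rewrite inE.
  exists (enum_rank_in xa' x); rewrite ?inE /f enum_rankK_in //.
have up_sub (C C' : {set 'I_#|~: a|}) : (up C \subset up C') = (C \subset C').
  apply/idP/idP => [sub|sub]; last by rewrite setUS ?imsetS.
  by rewrite -[C]upK -[C']upK preimsetS.
have up_card (C : {set 'I_#|~: a|}) : #|up C| = #|a| + #|C|.
  rewrite cardsU card_imset // (_ : _ :&: _ = set0) ?cards0 ?subn0 //.
  apply/setP=> x; rewrite !inE; apply/negP => /andP[xa /imsetP[y _ xE]].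
  by rewrite xE (negbTE (f_a y)) in xa.
have [||Q [QP cover inj]] := @greedy_partition _ (fun C => P (up C)) (cap t).
- exact: sub_cap.
- by move=> A A' _ _; apply: cap_cross.
exists [set up A | A in Q], (fun A => up (cap t (dn A))); split; first split.
- move=> _ /imsetP[A AQ ->]; have [PA sA] := QP A AQ.
  by rewrite upK up_sub.
- move=> C PC; have aC := proper_sub (aP _ PC).
  have [|A AQ [AC CA]] := cover (dn C); first by rewrite dnK.
  exists (up A); first exact: imset_f.
  by rewrite upK -[C]dnK ?up_sub.
- move=> _ _ C /imsetP[A AQ ->] /imsetP[A' A'Q ->]; rewrite !upK.
  move=> AC; have aC : a \subset C := subset_trans (subsetUl _ _) AC.
  move: AC; rewrite -[C]dnK // !up_sub => AC CA A'C CA'.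
  by congr up; apply: (inj _ _ (dn C)).
- move=> _ /imsetP[A AQ ->]; rewrite upK up_card leq_add2l.
  apply: cap_card => [k k0 kt|]; first by rewrite cardsCs setCK; exact: bound.
  have [/aP + _] := QP A AQ; rewrite properE => /andP[_]; apply: contra => /eqP ->.
  by rewrite /up imset0 setU0.
Qed.

Local Open Scope ring_scope.

(** * Vectors with labelled coordinates *)

(** Vectors over K whose coordinate i carries a set a i as its label. The indices
are ordered by the cardinal of their label, with ties broken by [rank_of]. *)
Section Labelled.
Variables (K : fieldType) (T : finType) (r : nat) (a : 'I_r -> {set T}).
Implicit Types (w : 'rV[K]_r) (B C : {set T}).

Definition supported B w : Prop := forall i, w 0 i != 0 -> a i \subset B.

Definition strictly_supported B w : Prop := forall i, w 0 i != 0 -> a i \proper B.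

Definition rank_of (i : 'I_r) : nat := (#|a i| * r + i)%N.

(** j is the leading index of w. *)
Definition lead (j : 'I_r) w : Prop :=
  w 0 j != 0 /\ forall i, w 0 i != 0 -> (rank_of i <= rank_of j)%N.

Lemma rank_of_inj : injective rank_of.
Proof.
move=> i j; rewrite /rank_of => eq_ij; apply/val_inj => /=.
have := congr1 (modn^~ r) eq_ij.
by rewrite /= !modnMDl !modn_small.
Qed.

Lemma rank_of_lt i j : (#|a i| < #|a j|)%N -> (rank_of i < rank_of j)%N.
Proof. by rewrite /rank_of => lt; have := ltn_ord i; nia. Qed.

Lemma card_rank_of i j : (rank_of i <= rank_of j)%N -> (#|a i| <= #|a j|)%N.
Proof. by apply: contraTT; rewrite -!ltnNge => /rank_of_lt. Qed.

Lemma lead_exists w : w != 0 -> exists j, lead j w.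
Proof.
case/rV0Pn => j0 j0P.
case: (@arg_maxnP _ j0 (fun j => w 0 j != 0) rank_of j0P) => j wj max.
by exists j.
Qed.

Lemma lead_supported j B w : lead j w -> supported B w -> a j \subset B.
Proof. by case=> wj _ /(_ j wj). Qed.

Lemma supported0 B : supported B 0.
Proof. by move=> i; rewrite mxE eqxx. Qed.

Lemma supportedB B w w' c :
  supported B w -> supported B w' -> supported B (w - c *: w').
Proof.
move=> sw sw' i; rewrite !mxE; have [-> | /sw // ] := eqVneq (w 0 i) 0.
by have [-> | /sw' // ] := eqVneq (w' 0 i) 0; rewrite mulr0 subr0 eqxx.
Qed.

Lemma strictly_supportedB B w w' c :
  strictly_supported B w -> strictly_supported B w' ->
  strictly_supported B (w - c *: w').
Proof.
move=> sw sw' i; rewrite !mxE; have [-> | /sw // ] := eqVneq (w 0 i) 0.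
by have [-> | /sw' // ] := eqVneq (w' 0 i) 0; rewrite mulr0 subr0 eqxx.
Qed.

(** Gaussian elimination: a property of all vectors of a class H may be proved by
subtracting multiples of vectors with the same leading index. *)
Lemma lead_ind (H P : 'rV[K]_r -> Prop) :
  P 0 ->
  (forall w, w != 0 -> H w -> exists j u, [/\ lead j w, lead j u,
     H (w - (w 0 j / u 0 j) *: u) & P (w - (w 0 j / u 0 j) *: u) -> P w]) ->
  forall w, H w -> P w.
Proof.
move=> P0 Pstep w Hw.
have [N] : exists N, forall i, w 0 i != 0 -> (rank_of i < N)%N.
  exists (\max_i rank_of i).+1 => i _; rewrite ltnS; exact: leq_bigmax.
elim: N w Hw => [|N IHN] w Hw wN.
  by rewrite (_ : w = 0) //; apply/rowP=> i; rewrite mxE; apply: contraTeq isT => /wN.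
have [->//|/Pstep /(_ Hw) [j [u [[wj wmax] [uj umax] Hw']]]] := eqVneq w 0.
apply; apply: IHN => // i; rewrite !mxE => nz.
have [eij|nij] := eqVneq i j.
  by rewrite eij mulfVK // subrr eqxx in nz.
have le_ij : (rank_of i <= rank_of j)%N.
  have [w0|/wmax//] := eqVneq (w 0 i) 0.
  have [u0|/umax//] := eqVneq (u 0 i) 0.
  by rewrite w0 u0 mulr0 subr0 eqxx in nz.
have := wN j wj; rewrite ltnS; apply: leq_trans; rewrite ltn_neqAle le_ij andbT.
by apply: contra nij => /eqP /rank_of_inj ->.
Qed.

End Labelled.
Arguments supported0 {K T r} a B.

(** * Exact sequences of matrices with labels *)

(** An exact sequence as it is seen in the squarefree multidegrees. The vectors of
level q stand for F_(q+1), Phi q for the map from level q+1 to level q, and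
Z q for the syzygies Z_(q+1), that is, the kernel at level q. *)
Section Chain.
Variables (K : fieldType) (T : finType) (e : int).
Variables (r : nat -> nat) (a : forall q, 'I_(r q) -> {set T}).
Variables (Phi : forall q, 'M[K]_(r q.+1, r q)) (Z : forall q, 'rV[K]_(r q) -> Prop).

Hypothesis Phi_label : forall q i k, Phi q i k != 0 -> a k \subset a i.
Hypothesis Z_sub : forall q (w w' : 'rV_(r q)) c, Z w -> Z w' -> Z (w - c *: w').
Hypothesis Z_Phi : forall q (h : 'rV_(r q.+1)), Z (h *m Phi q).
Hypothesis ZS : forall q (w : 'rV_(r q.+1)), Z w <-> w *m Phi q = 0.
(* Exactness in the multidegree of B. *)
Hypothesis Z_exact : forall q B (w : 'rV_(r q)),
  Z w -> supported (@a q) B w ->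
  exists2 h : 'rV_(r q.+1), supported (@a q.+1) B h & w = h *m Phi q.
(* F_1 maps to 0 in all total degrees less than e. *)
Hypothesis Z_base : forall i : 'I_(r 0), #|a i|%:Z < e -> Z (delta_mx 0 i).

(** The syzygies of level q with a leading index j of low degree: j is also the
leading index of a syzygy in the degree of the label of j itself. *)
Definition low_lead q := forall (j : 'I_(r q)) z, Z z -> lead (@a q) j z ->
  #|a j|%:Z < e + q%:Z ->
  exists u, [/\ Z u, supported (@a q) (a j) u & lead (@a q) j u].

Lemma low_lead0 : low_lead 0.
Proof.
move=> j z _ _; rewrite addr0 => low; exists (delta_mx 0 j).
have dj i : (delta_mx 0 j : 'rV[K]_(r 0)) 0 i != 0 -> i = j.
  by rewrite mxE; case: (eqVneq i j) => // _; rewrite andbF eqxx.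
split; first exact: Z_base.
  by move=> i /dj ->.
by split=> [|i /dj -> //]; rewrite mxE !eqxx oner_eq0.
Qed.

(** The syzygies in a low degree B that are combinations of basis elements of strictly
smaller degree are combinations of syzygies of strictly smaller degree. *)
Lemma low_decomp q : low_lead q ->
  forall (B : {set T}) (z : 'rV_(r q)), #|B|%:Z <= e + q%:Z -> Z z ->
  strictly_supported (@a q) B z ->
  exists2 h : 'rV_(r q.+1), strictly_supported (@a q.+1) B h & z = h *m Phi q.
Proof.
move=> low B z cB Zz sz.
pose H w := Z w /\ strictly_supported (@a q) B w.
have {Zz sz} Hz : H z by [].
move: z Hz; apply: (@lead_ind _ _ _ (@a q)) => [|z nz [Zz sz]].
  by exists 0; [move=> i; rewrite mxE eqxx | rewrite mul0mx].
have [j jz] := lead_exists (@a q) nz.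
have aB : a j \proper B := sz j jz.1.
have [|u [Zu su ju]] := low j z Zz jz.
  by have := proper_card aB; move: cB; lia.
have su' : strictly_supported (@a q) B u.
  by move=> i /su ai; exact: sub_proper_trans ai aB.
exists j, u; split=> //; first by split; [exact: Z_sub | exact: strictly_supportedB].
case=> h sh zE; have [h' sh' uE] := Z_exact Zu su.
exists (h - (- (z 0 j / u 0 j)) *: h').
  by apply: strictly_supportedB => // i /sh' ai; exact: sub_proper_trans ai aB.
by rewrite mulmxBl -scalemxAl -zE -uE scaleNr opprK subrK.
Qed.

Lemma low_leadS q : low_lead q -> low_lead q.+1.
Proof.
move=> low j z Zz [zj zmax] cj.
pose y : 'rV_(r q.+1) := \row_i (if a i == a j then z 0 i else 0).
(* y is z truncated to the label a j. By maximality of the rank of j, no other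
   coordinate of z contributes to the coordinates of z Phi labelled a j, so these
   vanish for y Phi as well. *)
have sy : strictly_supported (@a q) (a j) (y *m Phi q).
  move=> k nz; rewrite properEneq; apply/andP; split; last first.
    apply: contraNT nz => nsub; rewrite mxE big1 // => i _; rewrite mxE.
    case: eqP => [eij|]; last by rewrite mul0r.
    apply/eqP; rewrite mulf_eq0; apply/orP; right.
    by apply: contraR nsub => /Phi_label; rewrite eij.
  apply: contraNneq nz => kj.
  have /ZS /rowP/(_ k) := Zz; rewrite [RHS]mxE => <-; apply/eqP.
  rewrite !mxE; apply: eq_bigr => i _; rewrite mxE; case: eqP => // nij.
  have [->|/zmax/card_rank_of le_ij] := eqVneq (z 0 i) 0; first by rewrite mul0r.
  have [->|/Phi_label] := eqVneq (Phi q i k) 0; first by rewrite !mulr0.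
  rewrite kj => ji; case: nij; apply/esym/eqP.
  by rewrite eqEcard ji.
have [|h sh yE] := low_decomp low _ (@Z_Phi q y) sy.
  by move: cj; lia.
have hj : h 0 j = 0 by apply: contraTeq isT => /sh; rewrite properxx.
have yj : y 0 j = z 0 j by rewrite mxE eqxx.
exists (y - 1 *: h); split.
- by apply/ZS; rewrite mulmxBl scale1r yE subrr.
- apply: supportedB => i; last by move/sh/proper_sub.
  by rewrite mxE; case: (a i =P a j) => [->|]; rewrite ?eqxx.
split=> [|i]; first by rewrite !mxE hj eqxx mulr0 subr0.
rewrite scale1r !mxE; case: (a i =P a j) => [eij|_].
  have [hi|/sh] := eqVneq (h 0 i) 0; last by rewrite eij properxx.
  by rewrite hi subr0; exact: zmax.
rewrite sub0r oppr_eq0 => /sh /proper_card /rank_of_lt /ltnW; exact.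
Qed.

Lemma low_lead_all q : low_lead q.
Proof. by elim: q => [|q]; [exact: low_lead0 | exact: low_leadS]. Qed.

End Chain.

(** * Homogeneous elements of free modules *)
Section Degrees.
Variable n : nat.
Implicit Types (b x y : multideg n) (m : 'X_{1..n}).

(** The componentwise order on multidegrees. *)
Definition mdle x b : bool := [forall l, x l <= b l].

(** The exponent b - x, which is meaningful if x <= b. *)
Definition mdiff b x : 'X_{1..n} := [multinom `|b l - x l|%N | l < n].

Lemma multideg_ext x y : (forall l, x l = y l :> int) -> x = y.
Proof. by move=> xy; apply/ffunP. Qed.

Lemma multidegDE x y l : (x + y) l = x l + y l :> int.
Proof. by rewrite ffunE. Qed.

Lemma mon_degE m l : mon_deg m l = m l :> int.
Proof. by rewrite ffunE. Qed.

Lemma mdleP x b : reflect (forall l, x l <= b l) (mdle x b).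
Proof. exact: forallP. Qed.

Lemma mdle_trans y x b : mdle x y -> mdle y b -> mdle x b.
Proof. by move=> /mdleP xy /mdleP yb; apply/mdleP => l; apply: le_trans (yb l). Qed.

Lemma mdiffE b x l : mdiff b x l = `|b l - x l|%N.
Proof. by rewrite mnmE. Qed.

Lemma mdiffK b x : mdle x b -> x + mon_deg (mdiff b x) = b.
Proof.
move=> /mdleP xb; apply: multideg_ext => l.
by rewrite multidegDE mon_degE mdiffE; have := xb l; lia.
Qed.

Lemma mon_deg_addE b x m : (x + mon_deg m == b) = mdle x b && (m == mdiff b x).
Proof.
apply/eqP/andP => [<-|[xb /eqP ->]]; last exact: mdiffK.
split; first by apply/mdleP=> l; rewrite multidegDE mon_degE; lia.
by apply/eqP/mnmP => l; rewrite mdiffE multidegDE mon_degE; lia.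
Qed.

Lemma mdiffD b x m : mdle x b -> mdiff (b + mon_deg m) x = (m + mdiff b x)%MM.
Proof.
move=> /mdleP xb; apply/mnmP => l; rewrite mnmDE !mdiffE multidegDE mon_degE.
by have := xb l; lia.
Qed.

Lemma mdiff_trans b x y : mdle x y -> mdle y b ->
  (mdiff b y + mdiff y x)%MM = mdiff b x.
Proof.
move=> /mdleP xy /mdleP yb; apply/mnmP => l; rewrite mnmDE !mdiffE.
by have := xy l; have := yb l; lia.
Qed.

Lemma mon_deg0 : mon_deg (0%MM : 'X_{1..n}) = 0.
Proof. by apply: multideg_ext => l; rewrite mon_degE ffunE mnm0E. Qed.

End Degrees.

Lemma sum_pred1_seq (V : zmodType) (I : eqType) (s : seq I) (j : I) (F : I -> V) :
  uniq s -> \sum_(i <- s | i == j) F i = if j \in s then F j else 0.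
Proof.
move=> us; rewrite big_mkcond; case: ifP => js; last first.
  by rewrite big1_seq // => i /= si; case: eqP si => // ->; rewrite js.
rewrite (bigD1_seq j) //= eqxx big1 ?addr0 // => i; by case: eqP.
Qed.

Section Homogeneous.
Variables (K : fieldType) (n : nat) (V : gradedModule K n).
Implicit Types (b : multideg n) (v : V).

Lemma homogeneous_sum (I : eqType) (s : seq I) (p : pred I) (y : I -> V) b :
  (forall i, i \in s -> p i -> homogeneous b (y i)) ->
  homogeneous b (\sum_(i <- s | p i) y i).
Proof.
move=> yb; rewrite big_seq_cond; apply: (big_ind (@homogeneous _ _ V b)).
- exact: homogeneous0.
- by move=> v w; exact: homogeneousD.
- by move=> i /andP[]; exact: yb.
Qed.

Lemma homogeneousZ c v b : homogeneous b v -> homogeneous b (c%:MP *: v).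
Proof.
move/(homogeneous_monom c 0%MM); rewrite mon_deg0 addr0.
by rewrite mpolyX0 -mul_mpolyC mulr1.
Qed.

Lemma homogeneousB v w b :
  homogeneous b v -> homogeneous b w -> homogeneous b (v - w).
Proof.
move=> hv /(homogeneousZ (-1)); rewrite mpolyCN mpolyC1 scaleN1r.
exact: homogeneousD.
Qed.

Lemma homogeneous_sum0 (s : seq (multideg n)) (w : multideg n -> V) :
  uniq s -> (forall b, b \in s -> homogeneous b (w b)) ->
  \sum_(b <- s) w b = 0 -> forall b, b \in s -> w b = 0.
Proof. by have [_ _] := homogeneous_direct V; apply. Qed.

(** In a sum of homogeneous elements, only those of degree b contribute to a
homogeneous value of degree b. *)
Lemma homogeneous_part (I : eqType) (s : seq I) (y : I -> V)
    (f : I -> multideg n) b v :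
  homogeneous b v -> (forall i, i \in s -> homogeneous (f i) (y i)) ->
  v = \sum_(i <- s) y i -> v = \sum_(i <- s | f i == b) y i.
Proof.
move=> hv hy vE; pose s' := undup (b :: map f s).
pose w b' := \sum_(i <- s | f i == b') y i - (if b' == b then v else 0).
have bs' : b \in s' by rewrite mem_undup inE eqxx.
suff /eqP : w b = 0 by rewrite /w eqxx subr_eq0 => /eqP.
apply: (@homogeneous_sum0 s' w) => //; first exact: undup_uniq.
  move=> b' _; apply: homogeneousB.
    by apply: homogeneous_sum => i si /eqP <-; exact: hy.
  by case: eqP => [->//|_]; exact: homogeneous0.
rewrite /w sumrB -big_mkcond /= sum_pred1_seq ?undup_uniq // bs'.
rewrite (exchange_big_dep predT) //= vE; apply/eqP; rewrite subr_eq0; apply/eqP.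
rewrite [LHS]big_seq [RHS]big_seq; apply: eq_bigr => i si.
rewrite (eq_bigl (pred1 (f i))); last by move=> b'; rewrite /= eq_sym.
by rewrite sum_pred1_seq ?undup_uniq // mem_undup inE map_f ?orbT.
Qed.

End Homogeneous.

Lemma homogeneous_expand (K : fieldType) (n : nat) (V : gradedModule K n) (r : nat)
    (g : 'I_r -> V) (al : 'I_r -> multideg n) (c : 'I_r -> {mpoly K[n]}) b :
  (forall i, homogeneous (al i) (g i)) -> homogeneous b (\sum_(i < r) c i *: g i) ->
  \sum_(i < r) c i *: g i =
  \sum_(i < r) \sum_(m <- msupp (c i) | al i + mon_deg m == b)
     ((c i)@_m *: 'X_[m]) *: g i.
Proof.
move=> g_hom hv; set v := LHS in hv *.
pose s := [seq (i, m) | i <- index_enum 'I_r, m <- msupp (c i)].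
pose y (im : 'I_r * 'X_{1..n}) := ((c im.1)@_im.2 *: 'X_[im.2]) *: g im.1.
pose f (im : 'I_r * 'X_{1..n}) := al im.1 + mon_deg im.2.
have vs : v = \sum_(im <- s) y im.
  rewrite /s big_allpairs_dep; apply: eq_bigr => i _.
  by rewrite {1}[c i]mpolyE scaler_suml.
rewrite [LHS](homogeneous_part (f := f) (b := b) _ _ vs) //; last first.
  by move=> im _; exact: homogeneous_monom.
rewrite big_mkcond /s big_allpairs_dep; apply: eq_bigr => i _.
by rewrite -big_mkcond.
Qed.

(** The S-linear independence of a finite family. *)
Definition free_family (K : fieldType) (n : nat) (V : gradedModule K n) (r : nat)
    (g : 'I_r -> V) : Prop :=
  forall c : 'I_r -> {mpoly K[n]},
    \sum_(i < r) c i *: g i = 0 -> forall i, c i = 0.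
Section Basis.
Variables (K : fieldType) (n : nat) (V : gradedModule K n).
Variables (r : nat) (g : 'I_r -> V) (al : 'I_r -> multideg n).
Hypothesis g_hom : forall i, homogeneous (al i) (g i).
Hypothesis g_gen : generates g (whole V).
Hypothesis g_free : free_family g.
Implicit Types (b : multideg n) (w : 'rV[K]_r).

(** The element of multidegree b with coefficients w in the homogeneous basis g,
namely the sum of the w_i x^(b - al_i) g_i. It has this meaning only if w is
below b, that is, if al_i <= b whenever w_i is nonzero. *)
Definition glift b w : V := \sum_(i < r) (w 0 i *: 'X_[mdiff b (al i)]) *: g i.

Definition below b w : Prop := forall i, w 0 i != 0 -> mdle (al i) b.

Lemma glift0 b : glift b 0 = 0.
Proof. by rewrite /glift big1 // => i _; rewrite mxE !scale0r. Qed.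

Lemma gliftB b w w' c : glift b (w - c *: w') = glift b w - c%:MP *: glift b w'.
Proof.
rewrite /glift scaler_sumr -sumrB; apply: eq_bigr => i _.
by rewrite !mxE scalerA mul_mpolyC scalerA -!scalerBl.
Qed.

Lemma belowB b w w' c : below b w -> below b w' -> below b (w - c *: w').
Proof.
move=> sw sw' i; rewrite !mxE; have [-> | /sw // ] := eqVneq (w 0 i) 0.
by have [-> | /sw' // ] := eqVneq (w' 0 i) 0; rewrite mulr0 subr0 eqxx.
Qed.

Lemma glift_homogeneous b w : below b w -> homogeneous b (glift b w).
Proof.
move=> wb; apply: homogeneous_sum => i _ _.
have [->|/wb le_b] := eqVneq (w 0 i) 0; first by rewrite !scale0r; exact: homogeneous0.
by rewrite -{1}(mdiffK le_b); exact: homogeneous_monom.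
Qed.

Lemma glift_eq0 b w : glift b w = 0 -> w = 0.
Proof.
move=> /g_free w0; apply/rowP => i; rewrite mxE.
have /(congr1 (mcoeff (mdiff b (al i)))) := w0 i.
by rewrite mcoeffZ mcoeffX eqxx mulr1 mcoeff0.
Qed.

Lemma glift_monom b w m : below b w ->
  'X_[m] *: glift b w = glift (b + mon_deg m) w.
Proof.
move=> wb; rewrite /glift scaler_sumr; apply: eq_bigr => i _; rewrite scalerA.
have [->|/wb le_b] := eqVneq (w 0 i) 0; first by rewrite !scale0r mulr0 scale0r.
by rewrite mdiffD // mpolyXD -scalerAr.
Qed.

Lemma homogeneous_glift b v :
  homogeneous b v -> exists2 w, below b w & v = glift b w.
Proof.
move=> hv; have [c vE] : exists c : 'I_r -> {mpoly K[n]}, v = \sum_(i < r) c i *: g i.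
  by apply/g_gen.
exists (\row_i (if mdle (al i) b then (c i)@_(mdiff b (al i)) else 0)).
  by move=> i; rewrite mxE; case: ifP; rewrite ?eqxx.
rewrite vE in hv *; rewrite (homogeneous_expand g_hom hv).
apply: eq_bigr => i _; rewrite mxE.
under eq_bigl => m do rewrite mon_deg_addE.
case: ifP => _ /=; last by rewrite big_pred0 // !scale0r.
rewrite sum_pred1_seq ?msupp_uniq //; case: ifP => // /negbT.
by rewrite -mcoeff_eq0 => /eqP->; rewrite !scale0r.
Qed.

End Basis.

Section Matrix.
Variables (K : fieldType) (n : nat) (V W : gradedModule K n) (phi : {linear V -> W}).
Hypothesis phi_deg : degree_preserving phi.
Variables (r : nat) (g : 'I_r -> V) (al : 'I_r -> multideg n).
Hypothesis g_hom : forall i, homogeneous (al i) (g i).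
Variables (t : nat) (h : 'I_t -> W) (be : 'I_t -> multideg n).
Hypothesis h_hom : forall i, homogeneous (be i) (h i).
Hypothesis h_gen : generates h (whole W).

(** Phi is the matrix of phi, the powers of the variables being determined by the
multidegrees. *)
Definition represents (Phi : 'M[K]_(r, t)) : Prop :=
  (forall i k, Phi i k != 0 -> mdle (be k) (al i)) /\
  forall b w, below al b w ->
    below be b (w *m Phi) /\ phi (glift g al b w) = glift h be b (w *m Phi).

Lemma matrix_exists : exists Phi, represents Phi.
Proof.
have /fin_all_exists[R RP] : forall i, exists w : 'rV[K]_t,
    below be (al i) w /\ phi (g i) = glift h be (al i) w.
  move=> i; have [w wb wE] := homogeneous_glift h_hom h_gen (phi_deg (g_hom i)).
  by exists w.
pose Phi := \matrix_(i, k) R i 0 k.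
have PhiP i k : Phi i k != 0 -> mdle (be k) (al i).
  by rewrite mxE; have [+ _] := RP i; apply.
exists Phi; split=> // b w wb; split.
  move=> k; apply: contraNT => nle; rewrite mxE big1 // => i _.
  have [->|/wb le_b] := eqVneq (w 0 i) 0; first by rewrite mul0r.
  have [->|/PhiP le_i] := eqVneq (Phi i k) 0; first by rewrite mulr0.
  by rewrite (mdle_trans le_i le_b) in nle.
rewrite /glift linear_sum /=.
under eq_bigr => i _ do rewrite linearZ /= (RP i).2 /glift scaler_sumr.
rewrite exchange_big; apply: eq_bigr => k _.
rewrite mxE scaler_suml scaler_suml; apply: eq_bigr => i _.
have -> : R i 0 k = Phi i k by rewrite mxE.
rewrite scalerA.
have [->|/wb le_b] := eqVneq (w 0 i) 0; first by rewrite !(mul0r, scale0r).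
have [->|/PhiP le_i] := eqVneq (Phi i k) 0; first by rewrite !(mulr0, scale0r).
by rewrite -scalerAl -scalerAr scalerA -mpolyXD mdiff_trans.
Qed.

End Matrix.

(** * Stanley decompositions of kernels *)
Section Indicator.
Variable n : nat.
Implicit Types (A B : {set 'I_n}) (b : multideg n).

(** The indicator of A as a multidegree, and as an exponent. *)
Definition indic A : multideg n := [ffun l => (l \in A)%:Z].

Definition indicm A : 'X_{1..n} := [multinom (l \in A : nat) | l < n].

(** The support of a multidegree b >= 0. *)
Definition msupport b : {set 'I_n} := [set l | 0 < b l].

Lemma indicE A l : indic A l = (l \in A) :> int.
Proof. by rewrite ffunE. Qed.

Lemma indicmE A l : indicm A l = (l \in A).
Proof. by rewrite mnmE. Qed.

Lemma mdle_indic A B : mdle (indic A) (indic B) = (A \subset B).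
Proof.
apply/mdleP/subsetP => AB l; last by have := AB l; rewrite !indicE; lia.
by move=> lA; have := AB l; rewrite !indicE lA; lia.
Qed.

Lemma mdle_indic_msupport A b : mdle (indic A) b -> A \subset msupport b.
Proof.
move=> /mdleP Ab; apply/subsetP => l lA; rewrite inE.
by have := Ab l; rewrite indicE lA; lia.
Qed.

Lemma msupport_mdle_indic A b :
  (forall l, 0 <= b l) -> A \subset msupport b -> mdle (indic A) b.
Proof.
move=> b0 /subsetP Ab; apply/mdleP => l; rewrite indicE.
by have := Ab l; rewrite inE; have := b0 l; case: (l \in A) => [_ /(_ isT)|]; lia.
Qed.

Lemma mdle_indic_ge0 A b : mdle (indic A) b -> forall l, 0 <= b l.
Proof. by move=> /mdleP Ab l; apply: le_trans (Ab l); rewrite indicE. Qed.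

Lemma mdiff_indic A B : A \subset B ->
  mdiff (indic B) (indic A) = (indicm B - indicm A)%MM.
Proof.
move=> AB; apply/mnmP => l; rewrite mdiffE mnmBE !indicmE !indicE.
by have := subsetP AB l; case: (l \in A) => [/(_ isT) ->|_]; case: (l \in B).
Qed.

End Indicator.

Section Kernel.
Variables (K : fieldType) (n : nat) (V W : gradedModule K n) (phi : {linear V -> W}).
Hypothesis phi_deg : degree_preserving phi.

Lemma kernel_decomp v : phi v = 0 ->
  exists (s : seq (multideg n)) (w : multideg n -> V),
    (forall b, b \in s -> homogeneous b (w b) /\ phi (w b) = 0) /\
    v = \sum_(b <- s) w b.
Proof.
have [_ /(_ v I) [s [w [us hw vE]]] _] := homogeneous_direct V.
rewrite vE linear_sum /= => ker; exists s, w; split=> // b bs; split; first exact: hw.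
by apply: (homogeneous_sum0 us _ ker) => // b' b's; exact/phi_deg/hw.
Qed.

Lemma homogeneous_preimage b v y : homogeneous b v -> v = phi y ->
  exists2 y', homogeneous b y' & v = phi y'.
Proof.
have [_ /(_ y I) [s [w [us hw yE]]] _] := homogeneous_direct V.
rewrite yE linear_sum /= => hv vE.
exists (\sum_(b' <- s | b' == b) w b').
  by apply: homogeneous_sum => b' b's /eqP <-; exact: hw.
rewrite linear_sum /=; apply: (homogeneous_part (f := id) hv _ vE) => b' b's.
exact/phi_deg/hw.
Qed.

End Kernel.

Section InVariables.
Variables (K : fieldType) (n : nat).
Implicit Types (A : {set 'I_n}) (f : {mpoly K[n]}).

Lemma in_variables0 A : in_variables A (0 : {mpoly K[n]}).
Proof. by move=> m i; rewrite msupp0. Qed.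

Lemma in_variablesD A f f' :
  in_variables A f -> in_variables A f' -> in_variables A (f + f').
Proof.
move=> fA f'A m i /msuppD_le; rewrite mem_cat => /orP[]; [exact: fA | exact: f'A].
Qed.

Lemma in_variablesZX A c (m : 'X_{1..n}) :
  (forall i, m i != 0%N -> i \in A) -> in_variables A (c *: 'X_[m] : {mpoly K[n]}).
Proof.
by move=> mA m' i /msuppZ_le; rewrite msuppX inE => /eqP ->; exact: mA.
Qed.

End InVariables.

(** The free module V has a basis g labelled by sets, and Phi is the matrix of phi.
Given interval partitions of [lead_sets j] for all j, the kernel of phi
gets a Stanley decomposition indexed by the pairs (j, A) with A in Q j. *)
Section Stanley.
Variables (K : fieldType) (n : nat) (V W : gradedModule K n) (phi : {linear V -> W}).
Hypothesis phi_deg : degree_preserving phi.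
Variables (r : nat) (g : 'I_r -> V) (a : 'I_r -> {set 'I_n}).
Local Notation al := (fun i => indic (a i)).
Hypothesis g_hom : forall i, homogeneous (indic (a i)) (g i).
Hypothesis g_gen : generates g (whole V).
Hypothesis g_free : free_family g.
Variables (t : nat) (h : 'I_t -> W) (be : 'I_t -> multideg n).
Hypothesis h_free : free_family h.
Variable Phi : 'M[K]_(r, t).
Hypothesis PhiP : represents phi g al h be Phi.

(** The sets A such that the kernel of phi has, in the multidegree of A, an element
with leading index j. *)
Definition lead_sets (j : 'I_r) : pred {set 'I_n} :=
  fun A => `[< exists z, [/\ z *m Phi = 0, supported a A z & lead a j z] >].

Lemma kernel_glift b w : below al b w -> phi (glift g al b w) = 0 <-> w *m Phi = 0.
Proof.
move=> wb; rewrite (PhiP.2 b w wb).2; split=> [/(glift_eq0 h_free)//|->].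
exact: glift0.
Qed.

Variables (Q : 'I_r -> {set {set 'I_n}}) (top : 'I_r -> {set 'I_n} -> {set 'I_n}).
Hypothesis Q_part : forall j, interval_partition (lead_sets j) (Q j) (top j).

Definition st_index : {set 'I_r * {set 'I_n}} := [set jA | jA.2 \in Q jA.1].
Local Notation X := st_index.
Definition lab (x : 'I_#|X|) : 'I_r * {set 'I_n} := enum_val x.
(* A kernel vector with leading index j and supported in A, for each pair (j, A). *)
Variable z : 'I_#|X| -> 'rV[K]_r.

Hypothesis z_ker : forall x, z x *m Phi = 0.
Hypothesis z_supp : forall x, supported a (lab x).2 (z x).
Hypothesis z_lead : forall x, lead a (lab x).1 (z x).

Definition st_gen x : V := glift g al (indic (lab x).2) (z x).
Definition st_vars x : {set 'I_n} := top (lab x).1 (lab x).2.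

Lemma labP x : (lab x).2 \in Q (lab x).1.
Proof. by have := enum_valP x; rewrite inE. Qed.

Lemma st_below x : below al (indic (lab x).2) (z x).
Proof. by move=> i /z_supp; rewrite mdle_indic. Qed.

(** In multidegree b of support C, a kernel vector with leading index j is reduced
by the generator whose interval in the partition for j contains C. *)
Lemma st_span v : phi v = 0 -> exists2 f : 'I_#|X| -> {mpoly K[n]},
  forall x, in_variables (st_vars x) (f x) & v = \sum_x f x *: st_gen x.
Proof.
move=> /(kernel_decomp phi_deg)[s [w [sw ->]]]; elim: s sw => [|b s IHs] sw.
  exists (fun=> 0) => [x|]; first exact: in_variables0.
  by rewrite big_nil big1 // => x _; rewrite scale0r.
have [|f fP fE] := IHs; first by move=> b' b's; apply: sw; rewrite inE b's orbT.
suff [f' f'P f'E] : exists2 f : 'I_#|X| -> {mpoly K[n]},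
    forall x, in_variables (st_vars x) (f x) & w b = \sum_x f x *: st_gen x.
  exists (fun x => f' x + f x) => [x|]; first exact: in_variablesD.
  rewrite big_cons fE f'E -big_split; apply: eq_bigr => x _ /=.
  by rewrite -scalerDl.
have [|hw ker] := sw b; first by rewrite mem_head.
have [y yb yE] := homogeneous_glift g_hom g_gen hw.
rewrite yE in ker *; move/(kernel_glift yb): ker => ker {w sw yE hw f fP fE IHs s}.
pose H y := below al b y /\ y *m Phi = 0.
have {yb ker} Hy : H y by [].
move: y Hy; apply: (@lead_ind _ _ _ a) => [|y ny [yb ker]].
  exists (fun=> 0) => [x|]; first exact: in_variables0.
  by rewrite glift0 big1 // => x _; rewrite scale0r.
have [j jy] := lead_exists a ny.
have b0 := mdle_indic_ge0 (yb j jy.1).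
have yC : supported a (msupport b) y by move=> i /yb /mdle_indic_msupport.
have [_ cover _] := Q_part j.
have [|A AQ [AC CA]] := cover (msupport b); first by apply/asboolP; exists y.
have jAX : (j, A) \in X by rewrite inE.
pose x := enum_rank_in jAX (j, A).
have labx : lab x = (j, A) by rewrite /lab enum_rankK_in.
have Ab := msupport_mdle_indic b0 AC.
have xb : below al b (z x).
  by move=> i /st_below; rewrite labx => /mdle_trans; apply.
have jx : lead a j (z x) by have := z_lead x; rewrite labx.
exists j, (z x); split=> //.
  split; first exact: belowB.
  by rewrite mulmxBl -scalemxAl z_ker ker scaler0 subrr.
set c := _ / _; case=> f fP fE.
pose f1 x' := if x' == x then c *: 'X_[mdiff b (indic A)] else 0 : {mpoly K[n]}.
exists (fun x' => f x' + f1 x').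
  move=> x'; apply: in_variablesD => //; rewrite /f1.
  case: eqP => [->|_]; last exact: in_variables0.
  apply: in_variablesZX => l; rewrite mdiffE indicE /st_vars labx => nz.
  apply: (subsetP CA); rewrite inE; have := b0 l; have := subsetP AC l; rewrite inE.
  by move: nz; case: (l \in A) => [_ /(_ isT)//|]; lia.
under eq_bigr => x' _ do rewrite scalerDl.
rewrite big_split /= -fE gliftB (bigD1 x) //= /f1 eqxx.
rewrite big1 => [|x' /negbTE ->]; last first.
  by rewrite scale0r.
rewrite addr0 -[c *: _]mul_mpolyC -scalerA /st_gen glift_monom //; last exact: st_below.
by rewrite labx mdiffK // subrK.
Qed.

(** In each multidegree b, the spaces that contribute have different leading
indices: a contributing pair (j, A) is determined by j, because the interval
of A contains the support of b. *)
Lemma st_free (f : 'I_#|X| -> {mpoly K[n]}) :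
  (forall x, in_variables (st_vars x) (f x)) ->
  \sum_x f x *: st_gen x = 0 -> forall x, f x = 0.
Proof.
move=> fP; rewrite /st_gen /glift.
under eq_bigr => x _ do rewrite scaler_sumr.
rewrite exchange_big /=.
under eq_bigr => i _ do under eq_bigr => x _ do rewrite scalerA.
under eq_bigr => i _ do rewrite -scaler_suml.
move=> /g_free f0 x0; apply/mpolyP => m0; rewrite mcoeff0.
(* Compare the coefficients in multidegree b; y x is the contribution of the
   generator x. *)
pose b := (indicm (lab x0).2 + m0)%MM.
pose y x := if (indicm (lab x).2 <= b)%MM then (f x)@_(b - indicm (lab x).2)%MM else 0.
have lab_sub x : y x != 0 -> (lab x).2 \subset msupport (mon_deg b)
    /\ msupport (mon_deg b) \subset st_vars x.
  rewrite /y; case: mnm_lepP => [le_b nz|]; last by rewrite eqxx.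
  split; apply/subsetP => l; rewrite inE mon_degE.
    by move=> lA; have := le_b l; rewrite indicmE lA; lia.
  have [_ _ _] := Q_part (lab x).1; have [QP _ _] := Q_part (lab x).1.
  have [_ /subsetP Atop] := QP _ (labP x).
  have [/Atop//|lA lb] := boolP (l \in (lab x).2).
  apply: (fP x (b - indicm (lab x).2)%MM); first by rewrite mcoeff_msupp.
  by rewrite mnmBE indicmE (negbTE lA) subn0; move: lb; lia.
have lab_inj x x' : y x != 0 -> y x' != 0 -> (lab x).1 = (lab x').1 -> x = x'.
  move=> /lab_sub[s1 s2] /lab_sub[s1' s2'] e1; apply: enum_val_inj.
  have e2 : (lab x).2 = (lab x').2.
    have [_ _ inj] := Q_part (lab x).1.
    apply: (inj _ _ (msupport (mon_deg b))) => //; first exact: labP.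
      by rewrite e1; exact: labP.
    by rewrite e1.
  by rewrite -/(lab x) -/(lab x') [LHS]surjective_pairing e1 e2 -surjective_pairing.
have sum0 i : \sum_x y x * z x 0 i = 0.
  have [le_b|nle_b] := boolP (indicm (a i) <= b)%MM; last first.
    rewrite big1 // => x _; have [->|/z_supp ai] := eqVneq (z x 0 i) 0.
      by rewrite mulr0.
    rewrite /y; case: ifP => [le_b|]; last by rewrite mul0r.
    case/negP: nle_b; apply: lepm_trans le_b; apply/mnm_lepP => l.
    by rewrite !indicmE; have := subsetP ai l; case: (l \in a i) => [/(_ isT) ->|].
  have := congr1 (mcoeff (b - indicm (a i))%MM) (f0 i).
  rewrite mcoeff0 raddf_sum /= => s0; rewrite -[RHS]s0; apply: eq_bigr => x _.
  have [->|/z_supp ai] := eqVneq (z x 0 i) 0.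
    by rewrite mulr0 scale0r mulr0 mcoeff0.
  rewrite mdiff_indic // -scalerAr mcoeffZ mulrC; congr (_ * _); rewrite /y.
  have le_ai l : (a i \subset (lab x).2) -> ((l \in a i) <= (l \in (lab x).2))%N.
    by move=> /subsetP/(_ l); case: (l \in a i) => [/(_ isT) ->|].
  case: mnm_lepP => [le_x|nle_x].
    rewrite -(mcoeffMX (f x) (indicm (lab x).2 - indicm (a i))); congr mcoeff.
    apply/mnmP => l; rewrite mnmDE !mnmBE !indicmE.
    have := le_x l; have := le_ai l ai; rewrite indicmE.
    by move: (b l) => bl; case: (l \in a i); case: (l \in (lab x).2) => //= _; lia.
  apply/esym/eqP; rewrite mcoeff_eq0 (perm_mem (msuppMX _ _)).
  apply/negP => /mapP[m _ mE]; apply: nle_x => l.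
  have := congr1 (fun m : 'X_{1..n} => m l) mE.
  rewrite /= mnmDE !mnmBE !indicmE; have := mnm_lepP le_b l; rewrite indicmE.
  have := le_ai l ai; move: (b l) (m l) => bl ml.
  by case: (l \in a i); case: (l \in (lab x).2) => //= _; lia.
have y0 x : y x = 0.
  apply/eqP; apply: contraT => nx.
  case: (@arg_maxnP _ x (fun x => y x != 0)
    (fun x => rank_of a (lab x).1) nx) => x1 nx1 max.
  have := sum0 (lab x1).1; rewrite (bigD1 x1) //= big1 => [|x' nx'].
    move/eqP; rewrite addr0 mulf_eq0 (negbTE nx1) /= => /eqP e.
    by have := (z_lead x1).1; rewrite e eqxx.
  have [->|nyx'] := eqVneq (y x') 0; first by rewrite mul0r.
  have [->|/(z_lead x').2 le1] := eqVneq (z x' 0 (lab x1).1) 0; first by rewrite mulr0.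
  have le2 := max _ nyx'; case/eqP: nx'; apply: lab_inj => //.
  by apply: (@rank_of_inj _ _ a); apply/eqP; rewrite eqn_leq le1 andbT; exact: le2.
by have := y0 x0; rewrite /y /b lem_addr [(_ + m0)%MM]addmC addmK.
Qed.

Lemma st_decomposition : stanley_decomposition (fun v => phi v = 0) st_gen st_vars.
Proof.
have st_ker x : phi (st_gen x) = 0 by apply/kernel_glift => //; exact: st_below.
split; [| |split].
- move=> x; split=> //; exists (indic (lab x).2).
  by apply: glift_homogeneous => //; exact: st_below.
- move=> x f fx f0; pose f' x' := if x' == x then f else 0.
  rewrite -[f](_ : f' x = f); last by rewrite /f' eqxx.
  apply: st_free => [x'|].
    by rewrite /f'; case: eqP => [->//|_]; exact: in_variables0.
  rewrite (bigD1 x) //= /f' eqxx f0 big1 ?addr0 // => x' /negbTE ->.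
  by rewrite scale0r.
- by move=> x _ [f _ ->]; rewrite linearZ /= st_ker scaler0.
- move=> v /st_span[f fP fE]; exists (index_enum 'I_#|X|), (fun x => f x *: st_gen x).
  split=> //; first exact: index_enum_uniq.
  by move=> x _; exists (f x).
- move=> s w us ws; rewrite big_uniq //= big_mkcond /= => w0.
  have /fin_all_exists[f fP] : forall x, exists f : {mpoly K[n]},
      in_variables (st_vars x) f /\ (if x \in s then w x else 0) = f *: st_gen x.
    move=> x; case: ifP => [/ws[f fx fE]|_]; first by exists f.
    by exists 0; split; [exact: in_variables0 | rewrite scale0r].
  have f0 : forall x, f x = 0.
    apply: st_free => [x|]; first exact: (fP x).1.
    by rewrite -[RHS]w0; apply: eq_bigr => x _; rewrite (fP x).2.
  by move=> x xs; have := (fP x).2; rewrite xs f0 scale0r.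
Qed.

End Stanley.

(** * Free squarefree modules and Stanley depth *)

(** A homogeneous basis whose multidegrees are indicators of sets. *)
Record labelled_basis (K : fieldType) (n : nat) (V : gradedModule K n) := LabelledBasis {
  lb_rank : nat;
  lb_gen : 'I_lb_rank -> V;
  lb_label : 'I_lb_rank -> {set 'I_n};
  lb_hom : forall i, homogeneous (indic (lb_label i)) (lb_gen i);
  lb_generates : generates lb_gen (whole V);
  lb_free : free_family lb_gen
}.

Section SquarefreeFree.
Variables (K : fieldType) (n : nat) (V : gradedModule K n).

Lemma free_family_factor (r : nat) (g : 'I_r -> V) :
  free_family g ->
  forall (c : 'I_r -> {mpoly K[n]}) i (f : {mpoly K[n]}),
  g i = f *: (\sum_(j < r) c j *: g j) -> f * c i = 1.
Proof.
move=> free c i f gE.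
have /(_ i) : forall j, f * c j - (j == i)%:R = 0.
  apply: free; under eq_bigr => j _ do rewrite scalerBl -scalerA.
  rewrite sumrB -scaler_sumr -gE (bigD1 i) //= eqxx scale1r big1 ?addr0 ?subrr //.
  by move=> j /negbTE ->; rewrite scale0r.
by rewrite eqxx => /eqP; rewrite subr_eq0 => /eqP.
Qed.

(** If a basis element g_i had degree at least 2 in x_l, then it would be a multiple
of x_l in a squarefree module. *)
Lemma squarefree_degree (r : nat) (g : 'I_r -> V) (al : 'I_r -> multideg n) :
  (forall i, homogeneous (al i) (g i)) -> generates g (whole V) ->
  free_family g ->
  squarefree (whole V) ->
  forall i, al i = indic [set l | al i l != 0].
Proof.
move=> g_hom g_gen g_free [_ _ sq0 sq1] i.
have gi0 : g i <> 0.
  move=> gi0; have := @free_family_factor _ _ g_free (fun=> 0) i 0.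
  rewrite mul0r scale0r => /(_ gi0) /eqP; by rewrite eq_sym oner_eq0.
have al_ge0 l : 0 <= al i l by apply: (sq0 _ (g i)) => //; split.
apply: multideg_ext => l; rewrite indicE inE.
have [->//|nz] := eqVneq (al i l) 0.
have [le1|gt1] := lerP (al i l) 1; first by have := al_ge0 l; move: nz le1; lia.
pose b : multideg n := [ffun k => al i k - (k == l)%:Z].
have bE k : b k = al i k - (k == l)%:Z :> int by rewrite ffunE.
have b_ge0 k : 0 <= b k.
  by rewrite bE; have [->|] := eqVneq k l; [move: gt1; lia | rewrite subr0].
have bl : b l <> 0 by rewrite bE eqxx; move: gt1; lia.
have balE : b + eps l = al i.
  by apply: multideg_ext => k; rewrite multidegDE bE ffunE subrK.
have [|v [[_ vE] _]] := sq1 b l b_ge0 bl (g i); first by rewrite balE; split.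
have [c vc] : exists c : 'I_r -> {mpoly K[n]}, v = \sum_(j < r) c j *: g j by apply/g_gen.
rewrite vc in vE; have /(congr1 (mcoeff 0%MM)) := free_family_factor g_free (esym vE).
rewrite mulrC mcoeff1 eqxx => /eqP.
suff /eqP -> : (c i * 'X_l)@_0%MM == 0 by rewrite eq_sym oner_eq0.
rewrite mcoeff_eq0 (perm_mem (msuppMX _ _)); apply/negP => /mapP[m _].
by move/(congr1 (fun m : 'X_{1..n} => m l)); rewrite /= mnmDE mnm1E eqxx mnm0E.
Qed.

Lemma labelled_basis_of : graded_free (whole V) -> squarefree (whole V) ->
  labelled_basis V.
Proof.
move=> free sq; have /cid[r /cid[g [/fin_all_exists/cid[al hom] gen fr]]] := free.
pose a i := [set l | al i l != 0].
have aE i : indic (a i) = al i by rewrite -(squarefree_degree hom gen fr sq).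
by apply: (@LabelledBasis _ _ _ r g a) => // i; rewrite aE.
Qed.

End SquarefreeFree.

Section StanleyDepth.
Variables (K : fieldType) (n : nat) (V : gradedModule K n) (P : V -> Prop).

Lemma full_decomposition_free r (u : 'I_r -> V) (Z : 'I_r -> {set 'I_n}) :
  submodule P -> stanley_decomposition P u Z -> (forall i, Z i = setT) ->
  graded_free P.
Proof.
case=> P0 PD PZ [uP uZ [spP dec ind]] ZT; exists r, u; split.
- by move=> i; have [] := uP i.
- move=> v; split=> [/dec[s [w [us sw ->]]]|[c ->]]; last first.
    by elim/big_ind: _ => // i _; apply: PZ; have [] := uP i.
  have /fin_all_exists[c cE] : forall i, exists c : {mpoly K[n]},
      (if i \in s then w i else 0) = c *: u i.
    move=> i; case: ifP => [/sw[f _ ->]|_]; first by exists f.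
    by exists 0; rewrite scale0r.
  exists c; rewrite big_uniq //= big_mkcond; apply: eq_bigr => i _; exact: cE.
- move=> c c0 i; apply: (uZ i); first by move=> m l _ _; rewrite ZT inE.
  apply: (ind (index_enum 'I_r) (fun i => c i *: u i)) => //.
  + exact: index_enum_uniq.
  + by move=> j _; exists (c j) => // m l _ _; rewrite ZT inE.
  + by rewrite mem_index_enum.
Qed.

Lemma decomposition_depth_le r (Z : 'I_r -> {set 'I_n}) :
  (decomposition_depth Z <= n)%N.
Proof.
rewrite /decomposition_depth; elim/big_ind: _ => // [x y xn _|i _].
  by rewrite geq_min xn.
by rewrite -[X in (_ <= X)%N]card_ord max_card.
Qed.

Lemma decomposition_depth_ge r (Z : 'I_r -> {set 'I_n}) t :
  (t <= n)%N -> (forall i, t <= #|Z i|)%N -> (t <= decomposition_depth Z)%N.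
Proof.
move=> tn tZ; rewrite /decomposition_depth; elim/big_ind: _ => // x y tx ty.
by rewrite leq_min tx.
Qed.

Lemma stanley_depth_ge r (u : 'I_r -> V) (Z : 'I_r -> {set 'I_n}) :
  stanley_decomposition P u Z ->
  exists2 k, is_stanley_depth P k & (decomposition_depth Z <= k)%N.
Proof.
move=> dec.
pose D k := `[< exists r (u : 'I_r -> V) (Z : 'I_r -> {set 'I_n}),
     stanley_decomposition P u Z /\ decomposition_depth Z = k >].
have exD : exists k, D k by exists (decomposition_depth Z); apply/asboolP; exists r, u, Z.
have leD k : D k -> (k <= n)%N.
  by move=> /asboolP[r' [u' [Z' [_ <-]]]]; exact: decomposition_depth_le.
case: (ex_maxnP exD leD) => k /asboolP Dk max; exists k.
  by split=> // r' u' Z' dec'; apply: max; apply/asboolP; exists r', u', Z'.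
by apply: max; apply/asboolP; exists r, u, Z.
Qed.

End StanleyDepth.

(** A module vanishes below the smallest degree of its generators. *)
Lemma degree_lt_generators_eq0 (K : fieldType) (n : nat) (V : gradedModule K n)
    (P : V -> Prop) e b v :
  smallest_generator_degree P e -> P v -> homogeneous b v ->
  total_degree b < e -> v = 0.
Proof.
case=> r [g [a [g_hom gen _ _ e_le]]] /gen[c ->] hv lt.
rewrite (homogeneous_expand g_hom hv) big1 // => i _; rewrite big_pred0 // => m.
apply/negbTE/negP => /eqP abE; move: lt; rewrite ltNge -abE /total_degree.
under eq_bigr => l _ do rewrite multidegDE mon_degE.
by rewrite big_split /= (le_trans (e_le i)) // lerDl sumr_ge0.
Qed.

(** A kernel in which the leading indices of degree less than D behave as in
[low_lead_all] has a Stanley decomposition of depth at least t. *)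
Lemma kernel_stanley (K : fieldType) (n : nat) (V W : gradedModule K n)
    (phi : {linear V -> W}) (B : labelled_basis V) (s : nat) (h : 'I_s -> W)
    (be : 'I_s -> multideg n) (Phi : 'M[K]_(lb_rank B, s)) (t : nat) (D : int) :
  degree_preserving phi ->
  free_family h ->
  represents phi (@lb_gen _ _ _ B) (fun i => indic (lb_label i)) h be Phi ->
  (forall (j : 'I_(lb_rank B)) z, z *m Phi = 0 -> lead (@lb_label _ _ _ B) j z ->
     #|lb_label j|%:Z < D ->
     exists u, [/\ u *m Phi = 0, supported (@lb_label _ _ _ B) (lb_label j) u
       & lead (@lb_label _ _ _ B) j u]) ->
  (t <= n)%N ->
  (forall c k : nat, D <= c%:Z -> (0 < k)%N -> (k < t - c)%N ->
     (k.+1 * ((t - c).+1 - k) <= (n - c).+1)%N) ->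
  exists r (u : 'I_r -> V) (Z : 'I_r -> {set 'I_n}),
    stanley_decomposition (fun v => phi v = 0) u Z /\ forall x, (t <= #|Z x|)%N.
Proof.
case: B Phi => r g a g_hom g_gen g_free Phi /= phi_deg h_free PhiP low tn bound.
have /fin_all_exists[Q /fin_all_exists[top QP]] : forall j, exists Q top,
    interval_partition (lead_sets a Phi j) Q top /\
    forall A, A \in Q -> (t <= #|top A|)%N.
  move=> j; have sub C : lead_sets a Phi j C -> a j \subset C.
    by move=> /asboolP[z [_ sz jz]]; exact: lead_supported jz sz.
  (* If a_j is itself in lead_sets, then one interval suffices; otherwise lead_sets
     is empty in low degree, and the circle is used in the remaining degrees. *)
have [aj|naj] := boolP (lead_sets a Phi j (a j)).
    exists [set a j], (fun=> setT); split; last first.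
      by move=> A _; rewrite cardsT card_ord.
    split=> [A|C PC|A A' C].
    - by rewrite inE => /eqP ->; rewrite subsetT.
    - by exists (a j); rewrite ?inE // sub // subsetT.
    - by rewrite !inE => /eqP -> /eqP ->.
  have [lt|le] := ltP #|a j|%:Z D.
    exists set0, id; split=> [|A]; last by rewrite inE.
    split=> [A|C /asboolP[z [zk _ jz]]|A A' C]; rewrite ?inE //.
    by case/negP: naj; apply/asboolP; exact: low zk jz lt.
  have [||Q [top [part tQ]]] :=
    @proper_upset_partition _ (a j) (lead_sets a Phi j) (t - #|a j|).
  - move=> C PC; rewrite properEneq sub // andbT.
    by apply: contraNneq naj => ->.
  - by move=> k k0 kt; rewrite card_ord; exact: bound.
  exists Q, top; split=> // A /tQ; apply: leq_trans.
  by rewrite -leq_subLR.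
have part j := (QP j).1; have tQ j := (QP j).2.
have /fin_all_exists[z zP] : forall x : 'I_#|st_index Q|, exists z,
    [/\ z *m Phi = 0, supported a (lab x).2 z & lead a (lab x).1 z].
  move=> x; have [QP' _ _] := part (lab x).1.
  by have [/asboolP] := QP' _ (labP x).
have zk x : z x *m Phi = 0 by have [] := zP x.
have zs x : supported a (lab x).2 (z x) by have [] := zP x.
have zl x : lead a (lab x).1 (z x) by have [] := zP x.
exists #|st_index Q|, (st_gen g a z), (st_vars top); split.
  exact: (st_decomposition phi_deg g_hom g_gen g_free h_free PhiP part zk zs zl).
by move=> x; apply: tQ; exact: labP.
Qed.

(** * Syzygies of squarefree modules *)
Lemma total_degree_indic n (A : {set 'I_n}) : total_degree (indic A) = #|A|%:Z.
Proof.
rewrite /total_degree -sum1_card -[RHS]natz natr_sum [RHS]big_mkcond.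
by apply: eq_bigr => l _; rewrite indicE; case: (l \in A).
Qed.

Lemma syzygy_stanley (K : fieldType) (n : nat) (G : gradedModule K n)
    (G_free : graded_free (whole G)) (M : G -> Prop) (e : int)
    (M_deg : smallest_generator_degree M e) (F : squarefreeResolution M)
    (q t : nat) :
  (t <= n)%N ->
  (forall c k : nat, e + q%:Z <= c%:Z -> (0 < k)%N -> (k < t - c)%N ->
     (k.+1 * ((t - c).+1 - k) <= (n - c).+1)%N) ->
  exists r (u : 'I_r -> res_mod F q) (Z : 'I_r -> {set 'I_n}),
    stanley_decomposition (syzygy F q.+1) u Z /\ forall x, (t <= #|Z x|)%N.
Proof.
move=> tn bound.
pose B q := labelled_basis_of (res_free F q) (res_squarefree F q).
have [s [h [/fin_all_exists[be h_hom] h_gen h_free]]] := G_free.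
pose g q := @lb_gen _ _ _ (B q); pose a q := @lb_label _ _ _ (B q).
pose al q i := indic (a q i).
have [Psi PsiP] : exists Psi, represents (res_aug F) (g 0%N) (al 0%N) h be Psi.
  by apply: matrix_exists => //; [exact: res_aug_deg | exact: lb_hom].
have ex_Phi q' : exists Phi,
    represents (res_diff F q') (g q'.+1) (al q'.+1) (g q') (al q') Phi.
  apply: matrix_exists; [exact: res_diff_deg | exact: lb_hom | exact: lb_hom |].
  exact: lb_generates.
pose Phi q' := projT1 (cid (ex_Phi q')).
have PhiP q' : represents (res_diff F q') (g q'.+1) (al q'.+1) (g q') (al q') (Phi q').
  exact: projT2 (cid (ex_Phi q')).
have below_supp q' A (w : 'rV[K]_(lb_rank (B q'))) :
    supported (a q') A w <-> below (al q') (indic A) w.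
  by split=> sw i /sw; rewrite mdle_indic.
have below_T q' (w : 'rV[K]_(lb_rank (B q'))) : below (al q') (indic setT) w.
  by apply/below_supp => i _; rewrite subsetT.
pose Z q' : 'rV[K]_(lb_rank (B q')) -> Prop :=
  match q' with 0%N => fun w => w *m Psi = 0 | q''.+1 => fun w => w *m Phi q'' = 0 end.
have Z_syz q' b (w : 'rV[K]_(lb_rank (B q'))) : below (al q') b w ->
    Z q' w <-> syzygy F q'.+1 (glift (g q') (al q') b w).
  case: q' w => [|q'] w wb; apply: iff_sym.
    exact: (kernel_glift h_free PsiP wb).
  exact: (kernel_glift (@lb_free _ _ _ (B q')) (PhiP q') wb).
have syz_im q' v : syzygy F q'.+1 v <-> exists w, res_diff F q' w = v.
  by case: q' v => [|q'] v; [exact: res_exact0 | exact: res_exactS].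
have low := @low_lead_all K 'I_n e (fun q' => lb_rank (B q')) a Phi Z.
have {}low : low_lead e a Z q.
  apply: low => {q tn bound}.
  - by move=> q i k /(PhiP q).1; rewrite mdle_indic.
  - case=> [|q] w w' c /= Zw Zw'; rewrite mulmxBl -scalemxAl Zw Zw' ?scaler0 ?subr0 //.
  - move=> q w; apply/(Z_syz _ (indic setT)) => //; apply/syz_im.
    exists (glift (g q.+1) (al q.+1) (indic setT) w).
    by rewrite ((PhiP q).2 _ _ (below_T _ w)).2.
  - by [].
  - move=> q A w Zw /below_supp wA.
    have := glift_homogeneous (@lb_hom _ _ _ (B q)) wA => hw.
    have /syz_im[y yE] := (Z_syz _ _ _ wA).1 Zw.
    have [y' hy' y'E] := homogeneous_preimage (@res_diff_deg _ _ _ _ F q) hw (esym yE).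
    have [w' w'A w'E] := homogeneous_glift (@lb_hom _ _ _ (B q.+1))
      (@lb_generates _ _ _ (B q.+1)) hy'.
    exists w'; first exact/below_supp.
    apply/eqP; rewrite -subr_eq0 -[w' *m _]scale1r; apply/eqP.
    apply: (glift_eq0 (g := g q) (al := al q) (b := indic A) (@lb_free _ _ _ (B q))).
    by rewrite gliftB mpolyC1 scale1r -((PhiP q).2 _ _ w'A).2 -w'E -y'E subrr.
  - move=> i ci.
    have iA : below (al 0%N) (indic (a 0%N i))
        (delta_mx 0 i : 'rV[K]_(lb_rank (B 0%N))).
      move=> k; rewrite mxE; case: (eqVneq k i) => [->|_]; first by rewrite mdle_indic.
      by rewrite andbF eqxx.
    apply/(Z_syz _ _ _ iA).
    apply: (degree_lt_generators_eq0 (b := indic (a 0%N i)) M_deg).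
    + apply/res_aug_image.
      by exists (glift (g 0%N) (al 0%N) (indic (a 0%N i)) (delta_mx 0 i)).
    + apply: res_aug_deg; apply: glift_homogeneous iA; exact: lb_hom.
    + by rewrite total_degree_indic.
case: q tn bound low => [|q] tn bound low.
  exact: (kernel_stanley (@res_aug_deg _ _ _ _ F) h_free PsiP low tn bound).
exact: (kernel_stanley (@res_diff_deg _ _ _ _ F q) (@lb_free _ _ _ (B q))
  (PhiP q) low tn bound).
Qed.

Lemma syzygy_submodule (K : fieldType) (n : nat) (G : gradedModule K n)
    (M : G -> Prop) (F : squarefreeResolution M) p : submodule (syzygy F p).
Proof.
by case: p => [|[|p]]; split=> [|v w /= v0 w0|f v /= v0] /=;
  rewrite ?linear0 ?linearD ?linearZ /= ?v0 ?w0 ?addr0 ?scaler0.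
Qed.

(** The largest s with (2s + 1)(s + 1) <= N satisfies
2s + 3/2 <= sqrt (2N + 1/4) < 2s + 7/2. *)
Lemma floor_formula (R : realType) (N s : int) :
  (2 * s + 1) * (s + 1) <= N ->
  (forall t : int, (2 * t + 1) * (t + 1) <= N -> t <= s) ->
  Num.floor ((Num.sqrt ((2 * N - 2)%:~R + 9 / 4 : R) + 1 / 2) / 2) = s + 1.
Proof.
move=> s_ok s_max.
have N0 : 0 <= N.
  by apply: le_trans s_ok; have [s0|s0] := lerP 0 s; [nia|];
    rewrite mulr_le0 //; lia.
have s_ge : -1 <= s by apply: s_max; move: N0; lia.
have lt : N < (2 * s + 3) * (s + 2).
  rewrite ltNge; apply/negP => le; have := s_max (s + 1).
  have -> : (2 * (s + 1) + 1) * (s + 1 + 1) = (2 * s + 3) * (s + 2) by ring.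
  by move/(_ le); lia.
pose S := s%:~R : R; pose X := (2 * N - 2)%:~R + 9 / 4 : R.
have XE : X = 2 * N%:~R + 1 / 4 by rewrite /X rmorphB rmorphM /=; lra.
have S_ge : -1 <= S by rewrite -(ler_int R) in s_ge; move: s_ge; rewrite /S; lra.
have H1 : (2 * S + 1) * (S + 1) <= N%:~R.
  by move: s_ok; rewrite -(ler_int R) !(rmorphM, rmorphD) /=.
have H2 : N%:~R < (2 * S + 3) * (S + 2).
  by move: lt; rewrite -(ltr_int R) !(rmorphM, rmorphD) /=.
have N0' : 0 <= N%:~R :> R by rewrite ler0z.
have X0 : 0 <= X by rewrite XE; lra.
have q0 : 0 <= Num.sqrt X := sqrtr_ge0 X; have q2 := sqr_sqrtr X0.
move: q0 q2; rewrite -/X; move: (Num.sqrt X) => y y0 y2.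
have L1 : 2 * S + 3 / 2 <= y.
  by rewrite leNgt; apply/negP => lty; move: y2; rewrite XE expr2; nra.
have L2 : y < 2 * S + 7 / 2.
  by rewrite ltNge; apply/negP => lty; move: y2; rewrite XE expr2; nra.
by apply: floor_def; rewrite !intrD !mulr1z -/S; apply/andP; split; lra.
Qed.

Theorem theorem2p6 (R : realType) (K : fieldType) (n : nat)
    (G : gradedModule K n) (G_free : graded_free (whole G))
    (M : G -> Prop) (M_squarefree : squarefree M)
    (M_neq0 : exists v, M v /\ v <> 0)
    (d : int) (M_deg : smallest_generator_degree M (d + 1))
    (F : squarefreeResolution M)
    (p : nat) (p_ge1 : (1 <= p)%N)
    (s : int) (s_ok : (2 * s + 1) * (s + 1) <= n%:Z + 1 - d - p%:Z)
    (s_max : forall t : int,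
       (2 * t + 1) * (t + 1) <= n%:Z + 1 - d - p%:Z -> t <= s) :
  (graded_free (syzygy F p) \/
   exists k : nat,
     is_stanley_depth (syzygy F p) k /\ 2 * s + 1 + d + p%:Z <= k%:Z) /\
  2 * s + 1 + d + p%:Z =
    2 * Num.floor
          ((Num.sqrt ((2 * n%:Z - 2 * d - 2 * p%:Z)%:~R + 9 / 4 : R) + 1 / 2) / 2)
    + d + p%:Z - 1.
Proof.
split; last first.
  have -> : 2 * n%:Z - 2 * d - 2 * p%:Z = 2 * (n%:Z + 1 - d - p%:Z) - 2 by ring.
  by rewrite (floor_formula R s_ok s_max); ring.
case: p p_ge1 s_ok s_max => // q _ s_ok _.
set T := 2 * s + 1 + d + q.+1%:Z.
(* t is the minimum of n and T, or 0 if T is negative. *)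
pose t : nat := if T <= n%:Z then (if 0 <= T then `|T|%N else 0%N) else n.
have tn : (t <= n)%N by rewrite /t; case: ifP => //; case: ifP => //; lia.
have tT : (0 < t)%N -> t%:Z <= T.
  by rewrite /t; case: ifP => [_|/negbT]; [case: ifP | rewrite -ltNge]; lia.
have [|r [u [Z [dec tZ]]]] := syzygy_stanley G_free M_deg F (q := q) tn.
  move=> c k cD k0 kt.
  have tT' : t%:Z <= T by apply: tT; move: kt; lia.
  have : c%:Z + k%:Z < t%:Z by move: kt; lia.
  move: s_ok cD tT' tn k0; rewrite /T => s_ok cD tT' tn' k0 ck.
  (* kap is the excess of the size c of the label over d + p, and tau = t - c. *)
pose kap : int := c%:Z - (d + 1 + q%:Z).
  have kap0 : 0 <= kap by rewrite /kap; lia.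
  pose tau : int := t%:Z - c%:Z.
  have tau_le : tau <= 2 * s + 1 - kap by rewrite /tau /kap; lia.
  have s1 : 1 <= s by move: tau_le; rewrite /tau; lia.
  have key : (k%:Z + 1) * (tau + 1 - k%:Z) <= (2 * s + 1) * (s + 1) - kap.
    have k1 : 1 <= k%:Z by lia.
    move: tau_le kap0 s1 k1; move: (k%:Z) kap tau => x y z zle y0 s1 x1.
    have A1 : (x + 1) * (z + 1 - x) <= (x + 1) * (2 * s + 2 - y - x) by nia.
    have A2 : (x + 1) * (2 * s + 2 - y - x) <= (x + 1) * (2 * s + 2 - x) - y by nia.
    have A3 : (x + 1) * (2 * s + 2 - x) <= (s + 1) * (s + 2).
      have -> : (x + 1) * (2 * s + 2 - x) =
          (s + 1) * (s + 2) + (x - s) - (x - s) * (x - s) by ring.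
      by move: (x - s) => w; nia.
    have A4 : (s + 1) * (s + 2) <= (2 * s + 1) * (s + 1) by nia.
    by lia.
  rewrite -lez_nat PoszM.
  have -> : ((t - c).+1 - k)%N = tau + 1 - k%:Z :> int by rewrite /tau; lia.
  have -> : (n - c).+1 = n%:Z - c%:Z + 1 :> int by lia.
  have -> : k.+1 = k%:Z + 1 :> int by lia.
  by apply: le_trans key _; rewrite /kap; move: s_ok; lia.
have [Tn|nT] := lerP T n%:Z.
  right; have [k dk le_k] := stanley_depth_ge dec; exists k; split=> //.
  have := leq_trans (decomposition_depth_ge tn tZ) le_k.
  by rewrite /t Tn; case: ifP; lia.
left; apply: full_decomposition_free dec _; first exact: syzygy_submodule.
move=> x; apply/eqP; rewrite eqEcard subsetT cardsT card_ord.
by have := tZ x; rewrite /t leNgt nT.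
Qed.
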